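(* Suppose that $(\mathcal M,d_{\mathcal M})$ is a separable metric space and that $\emptyset\ne\mathcal C\subseteq\mathcal M$ satisfies $$\lim_{\Delta\to\infty}\frac1\Delta\,\mathrm{SEP}_\Delta(\mathcal C)=0.$$ Then for every $\Delta>0$ and $K>1$, $$\widehat{\mathrm{SEP}}_\Delta(\mathcal C;\mathcal M)\le\sum_{s=0}^\infty\frac1{K^s}\lim_{\varepsilon\to0^+}\sup_{z\in\mathcal M}\widehat{\mathrm{SEP}}_{K^s\Delta}\big(\mathcal C\cap B_{\mathcal M}(z,K^{s+1}\Delta+\varepsilon);\mathcal M\big).$$
   Context: Quantities may take the value $\infty$; the limits on the right exist because the expressions are nondecreasing in $\varepsilon$. $B_{\mathcal M}(z,r)=\{y: d_{\mathcal M}(z,y)\le r\}$. Subsets carry the restricted metric. For a partition $\mathcal P$ of a set $\mathcal C$ and $x\in\mathcal C$, $\mathcal P(x)$ is the element of $\mathcal P$ containing $x$. A random partition $\mathcal P$ of a metric space $(\mathcal C,d)$ consists of a probability space $(\Omega,\mathbb P)$ and set-valued maps $\Gamma^1,\Gamma^2,\ldots:\Omega\to2^{\mathcal C}$ that are strongly measurable (for every $i$ and every closed $E\subseteq\mathcal C$, $\{\omega: E\cap\Gamma^i(\omega)\ne\emptyset\}$ is $\mathbb P$-measurable) such that for every $\omega$, $\mathcal P^\omega=\{\Gamma^k(\omega)\}_{k\in\mathbb N}$ is a partition of $\mathcal C$ (empty clusters allowed). For $\Delta>0$ it is $\Delta$-bounded if $\mathrm{diam}(\mathcal P^\omega(x))\le\Delta$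 for all $\omega\in\Omega$, $x\in\mathcal C$. If $\mathcal C\subseteq\mathcal M$, it is radially $\Delta$-bounded with respect to $\mathcal M$ if $\mathrm{rad}_{\mathcal M}(\mathcal P^\omega(x))\le\Delta$ for all $\omega\in\Omega$, $x\in\mathcal C$, where $\mathrm{rad}_{\mathcal M}(\mathcal S)=\inf\{r\in[0,\infty]:\ \exists x\in\mathcal M,\ B_{\mathcal M}(x,r)\supseteq\mathcal S\}$. In either case (with the given $\Delta$), the random partition is $\sigma$-separating ($\sigma\ge0$) if $\mathbb P[\mathcal P(x)\ne\mathcal P(y)]\le\frac\sigma\Delta d_{\mathcal M}(x,y)$ for all $x,y\in\mathcal C$. $\mathrm{SEP}_\Delta(\mathcal C)$ is the infimum over $\sigma\ge0$ such that there is a $\Delta$-bounded $\sigma$-separating random partition of $\mathcal C$; $\widehat{\mathrm{SEP}}_\Delta(\mathcal C;\mathcal M)$ is the infimum over $\sigma\ge0$ such that there is a $\sigma$-separating random partition of $\mathcal C$ that is radially $\Delta$-bounded with respect to $\mathcal M$ (each is $\infty$ if no such random partition exists). *)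

(* Defs.v *)
From HB Require Import structures.
From mathcomp Require Import all_boot all_order all_algebra.
From mathcomp Require Import all_classical all_reals all_analysis.

Set Implicit Arguments.
Unset Strict Implicit.
Unset Printing Implicit Defensive.

Import Order.TTheory GRing.Theory Num.Theory.
Import numFieldNormedType.Exports.

Local Open Scope classical_set_scope.
Local Open Scope ring_scope.
Local Open Scope ereal_scope.

Definition separable (T : topologicalType) : Prop :=
  exists2 S : set T, countable S & dense S.

Section metric_notions.
Context {R : realType} {M : metricType R}.

(* The library's [closed_ball] is the closure of the open ball, which may be
   strictly smaller. The radius is extended because [rad] allows r = +oo. *)
Definition mcball (z : M) (r : \bar R) : set M :=
  [set y | (mdist z y)%:E <= r].

(* The diameter of set0 is -oo here; [diam] is only applied to clusters that
   contain a point. *)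
Definition diam (S : set M) : \bar R :=
  ereal_sup [set (mdist x y)%:E | x in S & y in S].

Definition rad (S : set M) : \bar R :=
  ereal_inf [set r : \bar R | 0 <= r /\ exists x : M, S `<=` mcball x r].

End metric_notions.

Section random_partitions.
Context {R : realType} {M : metricType R}.
Context {d : measure_display} {Omega : measurableType d}.
Implicit Types (C : set M) (Gamma : nat -> Omega -> set M) (w : Omega).

(* A set of sets: clusters with different indices may coincide. *)
Definition clusters Gamma w : set (set M) := range (fun k => Gamma k w).

(* [E] is closed in C for the restricted metric. *)
Definition strongly_measurable C (G : Omega -> set M) : Prop :=
  forall E : set M, E `<=` C -> closed (E : set (subspace C)) ->
    measurable [set w | E `&` G w !=set0].

(* The library's [partition] requires nonempty blocks, whereas clusters may be
   empty. *)
Definition random_partition C Gamma : Prop :=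
  (forall k, strongly_measurable C (Gamma k)) /\
  (forall w, partition (clusters Gamma w `\ set0) id C).

Definition cluster_of Gamma w (x : M) : set M := pblock (clusters Gamma w) id x.

Definition bounded_partition C Gamma (Delta : R) : Prop :=
  forall w x, C x -> diam (cluster_of Gamma w x) <= Delta%:E.

Definition radially_bounded_partition C Gamma (Delta : R) : Prop :=
  forall w x, C x -> rad (cluster_of Gamma w x) <= Delta%:E.

Definition separating (P : probability Omega R) C Gamma (Delta sigma : R) :
    Prop :=
  forall x y, C x -> C y ->
    P [set w | cluster_of Gamma w x <> cluster_of Gamma w y]
      <= (sigma / Delta * mdist x y)%:E.

End random_partitions.

Section moduli.
Context {R : realType} {M : metricType R}.

Definition SEP (Delta : R) (C : set M) : \bar R :=
  ereal_inf [set sigma%:E | sigma in [set sigma : R | (0 <= sigma)%R /\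
    exists (d : measure_display) (Omega : measurableType d)
           (P : probability Omega R) (Gamma : nat -> Omega -> set M),
      [/\ random_partition C Gamma,
          bounded_partition C Gamma Delta &
          separating P C Gamma Delta sigma]]].

(* The ambient space M is the carrier of C. *)
Definition SEPhat (Delta : R) (C : set M) : \bar R :=
  ereal_inf [set sigma%:E | sigma in [set sigma : R | (0 <= sigma)%R /\
    exists (d : measure_display) (Omega : measurableType d)
           (P : probability Omega R) (Gamma : nat -> Omega -> set M),
      [/\ random_partition C Gamma,
          radially_bounded_partition C Gamma Delta &
          separating P C Gamma Delta sigma]]].

End moduli.

(* Main.v *)
(* Call a labelling of C a random map from C to nat all of whose values at single
   points are random variables; its fibers form a random partition, except that
   strong measurability (hitting events of all closed sets) is not required.

   Choose n with SEP_(K^n Delta)(C) / (K^n Delta) small, and start from a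
   K^n Delta-bounded random partition of C. Going down the scales
   s = n - 1, ..., 0, each cluster lies in a ball of radius K^(s+1) Delta + eps
   whose center is picked measurably in a countable dense set, and it is split by
   an independent radially K^s Delta-bounded random partition of that ball. Two
   points in the same cluster are separated at scale s with probability at most
   sigma_s / (K^s Delta) times their distance, and these bounds add up. The
   independent partitions live on a countable product of probability spaces.

   Intersecting clusters destroys strong measurability, but every labelling can be
   made strongly measurable. Adjoin to the probability space a countable set t of
   points, keep the labels of the points of t only, and group all other points into
   fixed small cells. The sigma-algebra consists of the events whose section at t
   does not depend, up to a null set, on t once t is large enough; the probability
   of an event is that of its eventual section. Each given point belongs to t for
   all large t, so separation probabilities do not change. The hitting event of a
   labelled cluster is a countable union that increases with t, hence stabilizes,
   and a cell minus t meets a closed set E eventually never or always, according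
   to whether E has countably or uncountably many points in the cell. *)
Require Import Defs.
From HB Require Import structures.
From mathcomp Require Import all_boot all_order all_algebra.
From mathcomp Require Import all_classical all_reals all_analysis.
From mathcomp Require Import measurable_realfun lra.

Set Implicit Arguments.
Unset Strict Implicit.
Unset Printing Implicit Defensive.

Import Order.TTheory GRing.Theory Num.Theory.
Import numFieldNormedType.Exports.

Local Open Scope classical_set_scope.
Local Open Scope ring_scope.
Local Open Scope ereal_scope.

(** * Countable products of probability spaces *)

Section countable_product.
Context {R : realType} (d : nat -> measure_display)
  (T : forall i, measurableType (d i)) (P : forall i, probability (T i) R).

Definition coordinate_sets : set (set (forall i, T i)) :=
  [set A | exists i (B : set (T i)), measurable B /\ A = [set w | B (w i)]].

(** Integrands live here before any product measure exists. [product_space] below has the same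
    points, with the sigma-algebra generated by the cylinders. *)
Definition sequence_space : measurableType _ :=
  g_sigma_algebraType coordinate_sets.

Lemma measurable_coordinate (i : nat) (B : set (T i)) :
  measurable B -> measurable [set w : sequence_space | B (w i)].
Proof. by move=> mB; apply: sub_sigma_algebra; exists i, B. Qed.

Lemma measurable_dfwith (i : nat) :
  measurable_fun setT
    (fun z : sequence_space * T i => dfwith z.1 i z.2 : sequence_space).
Proof.
apply: (@measurability _ _ _ sequence_space _ _ coordinate_sets) => //=.
move=> _ [_ [j [B [mB ->]]] <-].
rewrite setTI; have [ij|ij] := eqVneq i j.
  move: B mB; rewrite -ij => B mB.
  rewrite [X in measurable X](_ : _ = setT `*` B); first exact: measurableX.
  by apply/seteqP; split => -[w u] /=; rewrite dfwithin// => -[].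
rewrite [X in measurable X](_ : _ =
    [set w : sequence_space | B (w j)] `*` setT).
  by apply: measurableX => //; exact: measurable_coordinate.
by apply/seteqP; split => -[w u] /=; rewrite dfwithout// => -[].
Qed.

Definition coordinate_integral (i : nat) (f : sequence_space -> \bar R)
    (w : sequence_space) : \bar R :=
  \int[P i]_u f (dfwith w i u).

(** Integrates out the coordinates from [n] to [n + m - 1], coordinate [n] outermost. The entries of
    the argument at these places are overwritten. *)
Fixpoint iterated_integral (n m : nat) (f : sequence_space -> \bar R) :=
  if m is m'.+1 then coordinate_integral n (iterated_integral n.+1 m' f) else f.

Definition agree (n : nat) (w w' : sequence_space) :=
  forall i, (i < n)%N -> w i = w' i.

Definition depends_below {S : Type} (n : nat) (f : sequence_space -> S) :=
  forall w w', agree n w w' -> f w = f w'.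

Lemma agreeW (m n : nat) w w' : (m <= n)%N -> agree n w w' -> agree m w w'.
Proof. by move=> mn H i im; apply: H; exact: leq_trans mn. Qed.

Lemma depends_belowW {S : Type} (m n : nat) (f : sequence_space -> S) :
  (m <= n)%N -> depends_below m f -> depends_below n f.
Proof. by move=> mn H w w' /(agreeW mn); exact: H. Qed.

Lemma agree_dfwith n w (u : T n) : agree n (dfwith w n u) w.
Proof. by move=> i i_n; rewrite dfwithout// gt_eqF. Qed.

Section nonnegative_measurable.
Variable f : sequence_space -> \bar R.
Hypotheses (f0 : forall w, 0 <= f w) (mf : measurable_fun setT f).

Lemma coordinate_integral_ge0 i w : 0 <= coordinate_integral i f w.
Proof. exact: integral_ge0. Qed.

Lemma measurable_section i (w : sequence_space) :
  measurable_fun setT (fun u : T i => f (dfwith w i u)).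
Proof.
exact: (measurableT_comp (measurableT_comp mf (@measurable_dfwith i))
  (measurable_pair1 w)).
Qed.

Lemma measurable_coordinate_integral i :
  measurable_fun setT (coordinate_integral i f).
Proof.
have mg := measurableT_comp mf (@measurable_dfwith i).
by apply: (measurable_fun_fubini_tonelli_F (m2 := P i) _ mg) => z; exact: f0.
Qed.
End nonnegative_measurable.

Lemma iterated_integral_ge0 n m f : (forall w, 0 <= f w) ->
  forall w, 0 <= iterated_integral n m f w.
Proof.
by elim: m n => //= m IH n f0 w; apply: coordinate_integral_ge0; exact: IH.
Qed.

Lemma measurable_iterated_integral n m f : (forall w, 0 <= f w) ->
  measurable_fun setT f -> measurable_fun setT (iterated_integral n m f).
Proof.
elim: m n => //= m IH n f0 mf; apply: measurable_coordinate_integral.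
  exact: iterated_integral_ge0.
exact: IH.
Qed.

Lemma coordinate_integralD i f g : (forall w, 0 <= f w) ->
  (forall w, 0 <= g w) -> measurable_fun setT f -> measurable_fun setT g ->
  coordinate_integral i (f \+ g) =
  coordinate_integral i f \+ coordinate_integral i g.
Proof.
move=> f0 g0 mf mg; apply/funext => w.
by rewrite /coordinate_integral ge0_integralD//; exact: measurable_section.
Qed.

Lemma iterated_integralD n m f g : (forall w, 0 <= f w) ->
  (forall w, 0 <= g w) -> measurable_fun setT f -> measurable_fun setT g ->
  iterated_integral n m (f \+ g) =
  iterated_integral n m f \+ iterated_integral n m g.
Proof.
move=> f0 g0 mf mg; elim: m n => //= m IH n; rewrite IH coordinate_integralD//.
- exact: iterated_integral_ge0.
- exact: iterated_integral_ge0.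
- exact: measurable_iterated_integral.
- exact: measurable_iterated_integral.
Qed.

(** Each integrand is constant, and a probability measure integrates a constant to itself. *)
Lemma iterated_integral_id n m f :
  depends_below n f -> iterated_integral n m f = f.
Proof.
elim: m n => //= m IH n Hf; rewrite IH; last exact: depends_belowW Hf.
apply/funext => w; rewrite /coordinate_integral.
rewrite (_ : (fun u => _) = cst (f w)); last first.
  by apply/funext => u; exact/Hf/agree_dfwith.
by rewrite integral_cst// -[RHS]mule1; congr (_ * _); exact: probability_setT.
Qed.

Lemma iterated_integral_add n m m' f :
  iterated_integral n (m + m') f =
  iterated_integral n m (iterated_integral (n + m) m' f).
Proof.
elim: m n => [n|m IH n]; first by rewrite addn0.
by rewrite addSn /= IH addSnnS.
Qed.

(** * Cylinders and their conditional measures *)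

Definition cylinder (n : nat) (A : set sequence_space) :=
  measurable A /\ depends_below n A.

Definition eindic (A : set sequence_space) (w : sequence_space) : \bar R :=
  (\1_A w)%:E.

Lemma eindic_ge0 A w : 0 <= eindic A w.
Proof. by rewrite lee_fin. Qed.

Lemma measurable_eindic A : measurable A -> measurable_fun setT (eindic A).
Proof. by move=> mA; apply/measurable_EFinP; exact: measurable_indic. Qed.

Lemma cylinderW m n A : (m <= n)%N -> cylinder m A -> cylinder n A.
Proof. by move=> mn [mA HA]; split => //; exact: depends_belowW HA. Qed.

Lemma cylinder_eindic n A : cylinder n A -> depends_below n (eindic A).
Proof.
by move=> [_ HA] w w' /HA; rewrite /eindic !indicE /in_mem/= /in_set/= => ->.
Qed.

Definition cylindrical : set (set sequence_space) :=
  [set A | exists n, cylinder n A].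

(** The probability of a cylinder given the coordinates below [n]. A cylinder has many admissible
    lengths; one is picked here, and [conditionalE] shows that the choice is immaterial. *)
Definition conditional (n : nat) (A : set sequence_space) :=
  iterated_integral n (xget 0%N [set m | cylinder m A] - n) (eindic A).

(** Two lengths differ by integrals over coordinates that the indicator does not see. The
    subtraction is truncated: nothing is integrated once [n] reaches [N]. *)
Lemma conditionalE N n A : cylinder N A ->
  conditional n A = iterated_integral n (N - n) (eindic A).
Proof.
rewrite /conditional; case: xgetP => [m _|/(_ N)//].
have key a b : (a <= b)%N -> cylinder a A ->
    iterated_integral n (b - n) (eindic A) =
    iterated_integral n (a - n) (eindic A).
  move=> ab /cylinder_eindic dA; have [an|/ltnW na] := leqP a n.
    by rewrite !iterated_integral_id//; exact: depends_belowW dA.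
  rewrite (_ : b - n = (a - n) + (b - a))%N; last first.
    by rewrite addnC addnBA// subnK.
  by rewrite iterated_integral_add (@iterated_integral_id (n + _))// subnKC.
move=> cm cN; have [mN|/ltnW Nm] := leqP m N.
  by rewrite (key m N).
by rewrite (key N m).
Qed.

Lemma conditional_cylinder n A : cylinder n A -> conditional n A = eindic A.
Proof. by move=> cA; rewrite (conditionalE n cA) subnn. Qed.

(** The tower property. The length is first raised to at least [n + 1], so that the truncated
    difference drops by exactly one. *)
Lemma conditionalS n A : cylindrical A ->
  conditional n A = coordinate_integral n (conditional n.+1 A).
Proof.
move=> [N cN].
have cM : cylinder (maxn N n.+1) A by apply: cylinderW cN; exact: leq_maxl.
rewrite !(conditionalE _ cM) (_ : _ - n = (maxn N n.+1 - n.+1).+1)%N//.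
by rewrite -subSn ?leq_maxr.
Qed.

Lemma conditional_ge0 n A w : 0 <= conditional n A w.
Proof. by apply: iterated_integral_ge0 => ?; exact: eindic_ge0. Qed.

Lemma measurable_conditional n A : cylindrical A ->
  measurable_fun setT (conditional n A).
Proof.
move=> [N cN]; rewrite (conditionalE _ cN).
apply: measurable_iterated_integral; first exact: eindic_ge0.
by apply: measurable_eindic; case: cN.
Qed.

Lemma conditional_additive n A B : cylindrical A -> cylindrical B ->
  A `&` B = set0 ->
  conditional n (A `|` B) = conditional n A \+ conditional n B.
Proof.
move=> [a ca] [b cb] AB0.
have {}ca : cylinder (maxn a b) A by apply: cylinderW ca; exact: leq_maxl.
have {}cb : cylinder (maxn a b) B by apply: cylinderW cb; exact: leq_maxr.
have cAB : cylinder (maxn a b) (A `|` B).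
  case: ca cb => [mA dA] [mB dB]; split; first exact: measurableU.
  by move=> w w' ww'; rewrite /setU/= (dA w w')// (dB w w').
rewrite !(conditionalE n ca, conditionalE n cb, conditionalE n cAB).
rewrite -iterated_integralD; last 4 first.
- exact: eindic_ge0.
- exact: eindic_ge0.
- by apply: measurable_eindic; case: ca.
- by apply: measurable_eindic; case: cb.
congr iterated_integral; apply/funext => w /=; rewrite /eindic -EFinD.
rewrite !indicE in_setU; case: (boolP (w \in A)) => [/set_mem wA|_] /=.
  case: (boolP (w \in B)) => [/set_mem wB|_]; last by rewrite addr0.
  by have : set0 w by rewrite -AB0.
by rewrite add0r.
Qed.

(** * The algebra of cylinders and the extension of its premeasure *)

Lemma cylindrical0 : cylindrical set0.
Proof. by exists 0%N; split. Qed.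

Lemma cylindricalU : setU_closed cylindrical.
Proof.
move=> A B [a ca] [b cb]; exists (maxn a b).
have [mA dA] : cylinder (maxn a b) A by apply: cylinderW ca; exact: leq_maxl.
have [mB dB] : cylinder (maxn a b) B by apply: cylinderW cb; exact: leq_maxr.
split; first exact: measurableU.
by move=> w w' ww'; rewrite /setU/= (dA w w')// (dB w w').
Qed.

Lemma cylindricalC : setC_closed cylindrical.
Proof.
move=> A [n [mA dA]]; exists n; split; first exact: measurableC.
by move=> w w' /dA; rewrite /setC/= => ->.
Qed.

Lemma cylindrical_coordinate (i : nat) (B : set (T i)) :
  measurable B -> cylindrical [set w | B (w i)].
Proof.
move=> mB; exists i.+1; split; first exact: measurable_coordinate.
by move=> w w' /(_ i (ltnSn i)) /= ->.
Qed.

(** A separate name for the product, whose measurable sets are the algebra of cylinders only. *)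
Definition cylinder_space := forall i, T i.

HB.instance Definition _ := Pointed.on cylinder_space.
HB.instance Definition _ := @isAlgebraOfSets.Build default_measure_display
  cylinder_space cylindrical cylindrical0 cylindricalU cylindricalC.

(** For a cylinder all relevant coordinates are integrated out, so the value at [point] is the value
    everywhere. *)
Definition premeasure (A : set cylinder_space) : \bar R :=
  conditional 0 A point.

Lemma premeasure0 : premeasure set0 = 0.
Proof.
have c0 : cylinder 0 set0 by split.
by rewrite /premeasure (conditional_cylinder c0) /eindic indic0.
Qed.

Lemma premeasure_ge0 A : 0 <= premeasure A.
Proof. exact: conditional_ge0. Qed.

Lemma premeasure_additive :
  @measure_function.semi_additive _ R cylinder_space premeasure.
Proof.
apply/(@additive2P _ R cylinder_space premeasure premeasure0) => A B mA mB AB0.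
by rewrite /premeasure (conditional_additive _ mA mB AB0).
Qed.

HB.instance Definition _ := @isContent.Build _ cylinder_space R premeasure
  premeasure_ge0 premeasure_additive.

(* If the bound failed, it would fail for the conditional measures given a first
   coordinate, then given a second one, and so on; but conditioning on enough
   coordinates turns the conditional measure of a cylinder into its indicator. *)
Lemma premeasure_sigma_subadditive :
  @measurable_subset_sigma_subadditive _ R cylinder_space premeasure.
Proof.
move=> A F mF mA AF; rewrite leNgt; apply/negP => lt0.
pose bad n w := \sum_(0 <= k <oo) conditional n (F k) w < conditional n A w.
have step n w : bad n w -> exists u : T n, bad n.+1 (dfwith w n u).
  rewrite /bad => badw; apply: contrapT => /forallNP good.
  move: badw; apply/negP; rewrite -leNgt (conditionalS _ mA).
  under eq_eseriesr do rewrite (conditionalS _ (mF _)).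
  rewrite /coordinate_integral -integral_nneseries//; last 2 first.
  - by move=> k; exact: (measurable_section (measurable_conditional _ (mF k))).
  - by move=> k u _; exact: conditional_ge0.
  apply: ge0_le_integral => //.
  - by move=> u _; exact: conditional_ge0.
  - exact: (measurable_section (measurable_conditional _ mA)).
  - apply: (ge0_emeasurable_sum (P := xpredT)).
      by move=> k u _ _; exact: conditional_ge0.
    move=> k _; exact: (measurable_section (measurable_conditional _ (mF k))).
  - by move=> u _; rewrite leNgt; apply/negP; exact: good.
pose next n w : T n := xget point [set u | bad n.+1 (dfwith w n u)].
pose W := fix W n := if n is m.+1 then dfwith (W m) m (next m (W m))
  else point : sequence_space.
have badW n : bad n (W n).
  elim: n => [|n IH] //=; rewrite /next; case: xgetP => [u _ //|].
  by have [u bu] := step _ _ IH => /(_ u).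
(* Coordinate [i] of [W n] is final once [n] exceeds [i], so the diagonal agrees with [W n] below
   [n]. *)
pose w : sequence_space := fun i => W i.+1 i.
have Ww n : agree n (W n) w.
  elim: n => [//|n IH] i; rewrite ltnS leq_eqVlt => /orP[/eqP ->//|i_n].
  by rewrite [W _]/= dfwithout ?gt_eqF//; exact: IH.
have eqW n B : cylinder n B -> conditional n B (W n) = eindic B w.
  by move=> cB; rewrite conditional_cylinder//; exact: (cylinder_eindic cB).
have [N cN] := mA.
have Aw : A w.
  have := badW N; rewrite /bad (eqW _ _ cN) /eindic indicE.
  case: (boolP (w \in A)) => [/set_mem//|_] /=; rewrite ltNge => /negP[].
  by apply: nneseries_ge0 => k _ _; exact: conditional_ge0.
have [k _ Fkw] := AF _ Aw; have [M cM] := mF k.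
(* Beyond the lengths of [A] and [F k], both conditional measures at [W n] are indicators at [w],
   equal to 1, which contradicts badness. *)
pose n := maxn N M; have := badW n; apply/negP; rewrite -leNgt.
rewrite eqW; last by apply: cylinderW cN; exact: leq_maxl.
have <- : conditional n (F k) (W n) = eindic A w.
  rewrite eqW; last by apply: cylinderW cM; exact: leq_maxr.
  by rewrite /eindic !indicE !mem_set.
rewrite (@nneseriesD1 _ _ k xpredT)//; last by move=> *; exact: conditional_ge0.
by rewrite leeDl// nneseries_ge0// => *; exact: conditional_ge0.
Qed.

HB.instance Definition _ := @Content_SigmaSubAdditive_isMeasure.Build _ R
  cylinder_space premeasure premeasure_sigma_subadditive.

Definition product_space : measurableType _ :=
  g_sigma_algebraType (@measurable _ cylinder_space).

Definition product_measure : set product_space -> \bar R :=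
  measure_extension premeasure.

HB.instance Definition _ := Measure.on product_measure.

Lemma product_measure_cylinder (A : set cylinder_space) :
  measurable A -> product_measure A = premeasure A.
Proof. exact: measurable_mu_extE. Qed.

Lemma product_measureT : product_measure setT = 1.
Proof.
have cT : cylinder 0 setT by split.
rewrite product_measure_cylinder; last by exists 0%N.
by rewrite /premeasure (conditional_cylinder cT) /eindic indicT.
Qed.

HB.instance Definition _ :=
  @Measure_isProbability.Build _ _ _ product_measure product_measureT.

Lemma measurable_product_coordinate (i : nat) (B : set (T i)) :
  measurable B -> measurable [set w : product_space | B (w i)].
Proof.
by move=> mB; apply: sub_sigma_algebra; exact: cylindrical_coordinate.
Qed.

(** Of the [i + 1] nested integrals only the innermost one, over coordinate [i], sees [B]; the
    others integrate a constant. *)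
Lemma product_measure_coordinate (i : nat) (B : set (T i)) :
  measurable B -> product_measure [set w | B (w i)] = P i B.
Proof.
move=> mB; rewrite product_measure_cylinder; last exact: cylindrical_coordinate.
rewrite /premeasure.
have c : cylinder i.+1 [set w : sequence_space | B (w i)].
  split; first exact: measurable_coordinate.
  by move=> w w' /(_ i (ltnSn i)) /= ->.
rewrite (conditionalE _ c) subn0 -addn1 iterated_integral_add add0n/=.
pose c0 : sequence_space -> \bar R := cst (P i B).
rewrite (_ : coordinate_integral i _ = c0).
  by rewrite iterated_integral_id.
apply/funext => w; rewrite /coordinate_integral /c0 /=.
rewrite (_ : (fun u => _) = (fun u => (\1_B u)%:E)).
  by rewrite integral_indic// setIT.
apply/funext => u; rewrite /eindic !indicE; congr (_%:R%:E).
by rewrite /in_mem/= /in_set/= dfwithin.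
Qed.

End countable_product.

(** * Events decided by large countable sets of points *)

Lemma measure_ae_iff {d : measure_display} {T : measurableType d} {R : realType}
    (mu : {measure set T -> \bar R}) (A B : set T) :
  measurable A -> measurable B -> {ae mu, forall w, A w <-> B w} -> mu A = mu B.
Proof.
have key C D : measurable C -> measurable D ->
    {ae mu, forall w, C w <-> D w} -> mu C <= mu D.
  move=> mC mD [N [mN N0 sN]].
  rewrite -[leRHS]adde0 -N0; apply: le_trans (measureU2 mu mD mN).
  apply: le_measure; rewrite ?inE//; first exact: measurableU.
  move=> w Cw; have [Dw|nDw] := pselect (D w); [by left|right].
  by apply: sN => /= -[/(_ Cw)].
move=> mA mB AB; apply/eqP; rewrite eq_le !key//.
by apply: filterS AB => w [AB BA]; split.
Qed.

Section cofinal_measure.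
Context {R : realType} {d : measure_display} {T : measurableType d}
  (P : probability T R) (S : Type).

(** Countable sets of points are represented by enumerations with repetitions and gaps; the gaps
    admit the empty set. *)
Definition enumeration := nat -> option S.

HB.instance Definition _ := gen_eqMixin enumeration.
HB.instance Definition _ := gen_choiceMixin enumeration.
HB.instance Definition _ := isPointed.Build enumeration (fun=> None).

Definition listed (t : enumeration) : set S := [set x | exists n, t n = Some x].

Definition merge_enumerations (F : nat -> enumeration) : enumeration :=
  fun m => if unpickle m is Some (n, k) then F n k else None.

Lemma listed_merge F n : listed (F n) `<=` listed (merge_enumerations F).
Proof.
by move=> x [k Fnk]; exists (pickle (n, k)); rewrite /merge_enumerations pickleK.
Qed.

Lemma listed_countable (A : set S) : countable A -> exists t, A `<=` listed t.
Proof.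
move=> /countable_injP[f fi].
exists (fun n => if pselect (exists2 x, A x & f x = n) is left h
  then Some (sval (cid2 h)) else None).
move=> x Ax; exists (f x); case: pselect => [h|[]]; last by exists x.
by case: cid2 => y Ay /= /fi ->//; rewrite inE.
Qed.

Lemma countable_listed (t : enumeration) : countable (listed t).
Proof.
apply/countable_injP; exists (fun x => xget 0%N [set n | t n = Some x]).
move=> x y; rewrite !inE => -[n tn] [m tm].
case: xgetP => [i _ ti|/(_ n)//]; case: xgetP => [j _ tj|/(_ m)//] ij.
by move: ti; rewrite /= ij tj => -[].
Qed.

Definition section_at (t : enumeration) (W : set (T * enumeration)) : set T :=
  [set w | W (w, t)].

Definition stable_above (t0 : enumeration) (W : set (T * enumeration)) :=
  forall t, listed t0 `<=` listed t ->
    measurable (section_at t W) /\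
    {ae P, forall w, W (w, t) <-> W (w, t0)}.

Definition eventually_stable : set (set (T * enumeration)) :=
  [set W | exists t0, stable_above t0 W].

Lemma stable_aboveW t0 t1 W :
  listed t0 `<=` listed t1 -> stable_above t0 W -> stable_above t1 W.
Proof.
move=> t01 st t t1t; have [mt aet] := st _ (subset_trans t01 t1t).
split => //; have [_ ae1] := st _ t01.
by apply: filterS2 aet ae1 => w -> ->.
Qed.

(** Countably many thresholds lie below their merged enumeration, and countably many null sets have
    a null union. *)
Lemma eventually_stable_sigma_algebra : sigma_algebra setT eventually_stable.
Proof.
split.
- by exists point => t _; split; [exact: measurable0|exact: aeW].
- move=> W [t0 st]; exists t0 => t /st[mt aet]; split.
    by rewrite /section_at setTD; exact: measurableC.
  by apply: filterS aet => w Ww; rewrite setTD /setC/= Ww.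
- move=> F /choice[t tF]; pose t0 := merge_enumerations t.
  have {}tF n : stable_above t0 (F n).
    by apply: stable_aboveW (tF n); exact: listed_merge.
  exists t0 => t1 t01; split.
    by apply: (bigcup_measurable (F := fun n => section_at t1 (F n))) => n _;
      have [] := tF n _ t01.
  have : {ae P, forall w, forall n, F n (w, t1) <-> F n (w, t0)}.
    by apply/ae_foralln => n; have [] := tF n _ t01.
  by apply: filterS => w eqw; split=> -[n _ /eqw Fn]; exists n.
Qed.

Definition cofinal_space : measurableType _ :=
  g_sigma_algebraType eventually_stable.

Lemma cofinal_measurableE (W : set cofinal_space) :
  measurable W = eventually_stable W.
Proof.
by have := measurable_g_measurableTypeE eventually_stable_sigma_algebra => ->.
Qed.

Definition stability_threshold (W : set (T * enumeration)) : enumeration :=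
  xget point [set t0 | stable_above t0 W].

Definition cofinal_measure (W : set cofinal_space) : \bar R :=
  P (section_at (stability_threshold W) W).

Lemma stability_thresholdP W : eventually_stable W ->
  stable_above (stability_threshold W) W.
Proof.
by move=> [t0 st0]; rewrite /stability_threshold; case: xgetP => // /(_ t0).
Qed.

Lemma cofinal_measureE (W : set cofinal_space) t : measurable W ->
  listed (stability_threshold W) `<=` listed t ->
  cofinal_measure W = P (section_at t W).
Proof.
rewrite cofinal_measurableE => /stability_thresholdP st tt.
have [m0 _] := st _ (@subset_refl _ _); have [mt aet] := st _ tt.
by apply: measure_ae_iff => //; apply: filterS aet => w [tW Wt]; split.
Qed.

Lemma cofinal_measure0 : cofinal_measure set0 = 0.
Proof. exact: measure0. Qed.

Lemma cofinal_measure_ge0 W : 0 <= cofinal_measure W.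
Proof. exact: measure_ge0. Qed.

Lemma cofinal_measure_sigma_additive : semi_sigma_additive cofinal_measure.
Proof.
move=> F mF tF mU.
(* Index 0 holds the threshold of the union and index [m + 1] that of [F m]. At an enumeration above
   all of them, additivity is that of [P] on sections. *)
pose thr n := if n is m.+1 then stability_threshold (F m)
  else stability_threshold (\bigcup_n F n).
pose t := merge_enumerations thr.
rewrite (@cofinal_measureE _ t mU (@listed_merge thr 0%N)).
have FE n : cofinal_measure (F n) = P (section_at t (F n)).
  exact: (cofinal_measureE (mF n) (@listed_merge thr n.+1)).
under eq_fun do under eq_bigr do rewrite FE.
have mFt n : measurable (section_at t (F n)).
  have := mF n; rewrite cofinal_measurableE => /stability_thresholdP st.
  by have [] := st _ (@listed_merge thr n.+1).
rewrite (_ : section_at t _ = \bigcup_n section_at t (F n))//.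
apply: measure_semi_sigma_additive => //.
- by move=> i j _ _ [w [Fi Fj]]; apply: tF => //; exists (w, t).
- exact: bigcup_measurable.
Qed.

HB.instance Definition _ := isMeasure.Build _ _ _ cofinal_measure
  cofinal_measure0 cofinal_measure_ge0 cofinal_measure_sigma_additive.

Lemma cofinal_measureT : cofinal_measure setT = 1.
Proof. exact: probability_setT. Qed.

HB.instance Definition _ :=
  @Measure_isProbability.Build _ _ _ cofinal_measure cofinal_measureT.

Lemma cofinal_measure_const (W : set cofinal_space) t0 (B : set T) :
  measurable B -> (forall t, listed t0 `<=` listed t -> section_at t W = B) ->
  measurable W /\ cofinal_measure W = P B.
Proof.
move=> mB WB.
have st : stable_above t0 W.
  move=> t t0t; rewrite WB//; split => //; apply/aeW => w.
  rewrite -[W (w, t)]/(section_at t W w) -[W (w, t0)]/(section_at t0 W w).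
  by rewrite !WB.
have mW : measurable W by rewrite cofinal_measurableE; exists t0.
split => //.
pose thr n := if n is 0%N then stability_threshold W else t0.
rewrite (cofinal_measureE mW (@listed_merge thr 0%N)) WB//.
exact: (@listed_merge thr 1%N).
Qed.

(** The union over [A] may be uncountable, but each section is a countable union and grows with [t].
    Once its probability has reached the supremum over all [t], it can grow only by null sets. *)
Lemma measurable_cofinal_bigcup (A : set S) (B : S -> set T) :
  (forall x, A x -> measurable (B x)) ->
  measurable ([set z | exists x, [/\ A x, listed z.2 x & B x z.1]] :
    set cofinal_space).
Proof.
move=> mB; set W := [set z | _].
have mW t : measurable (section_at t W).
  rewrite (_ : section_at t W = \bigcup_n
      (if t n is Some x then if `[< A x >] then B x else set0 else set0)).
    apply: bigcup_measurable => n _; case: (t n) => [x|//].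
    by case: asboolP => // Ax; exact: mB.
  apply/seteqP; split => w.
    by move=> [x [Ax [n /= tn] Bx]]; exists n => //; rewrite tn asboolT.
  move=> [n _]; case tn : (t n) => [x|//]; case: asboolP => // Ax Bx.
  by exists x; split => //; exists n.
have sub t t' : listed t `<=` listed t' -> section_at t W `<=` section_at t' W.
  by move=> tt' w [x [Ax tx Bx]]; exists x; split => //; exact: tt'.
pose f t := P (section_at t W).
pose s := ereal_sup (range f).
have fs t : f t <= s by apply: ereal_sup_ubound; exists t.
have sfin : s \is a fin_num.
  rewrite ge0_fin_numE; last by apply: le_trans (fs point); exact: measure_ge0.
  apply: (@le_lt_trans _ _ 1); last exact: ltry.
  by apply: ge_ereal_sup => _ [t _ <-]; exact: probability_le1.
have /choice[tn tnP] : forall n, exists t, s - (n.+1%:R^-1)%:E < f t.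
  move=> n; have e0 : (0 < n.+1%:R^-1 :> R)%R by rewrite invr_gt0.
  by have [_ [t _ <-] ?] := ub_ereal_sup_adherent e0 sfin; exists t.
(* The supremum is attained at [t0], whose section contains those at all [tn n]. *)
pose t0 := merge_enumerations tn.
have ft0 : f t0 = s.
  apply/eqP; rewrite eq_le fs/=; apply/lee_addgt0Pr => e e0.
  have [n _ ne] : \forall n \near \oo, (n.+1%:R^-1 < e)%R.
    by exact: near_infty_natSinv_lt (PosNum e0).
  have {}ne := ne n (leqnn n).
  rewrite -leeBlDr//; apply: le_trans (_ : s - n.+1%:R^-1%:E <= _).
    by rewrite leeD2l// leeN2 lee_fin ltW.
  apply: ltW; apply: lt_le_trans (tnP n) _.
  by apply: le_measure; rewrite ?inE//; apply/sub/listed_merge.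
rewrite cofinal_measurableE; exists t0 => t t0t; split => //.
exists (section_at t W `\` section_at t0 W); split.
- exact: measurableD.
- rewrite measureD//; last first.
    by apply: (@le_lt_trans _ _ 1); [exact: probability_le1|exact: ltry].
  rewrite setIidr; last exact: sub.
  have Pt : f t = f t0.
    apply/eqP; rewrite eq_le ft0 fs/= -ft0.
    by apply: le_measure; rewrite ?inE//; exact: sub.
  by rewrite -[X in _ - X = _]/(f t0) -[X in X - _ = _]/(f t) Pt ft0 subee.
- move=> w /= nW; split.
    by apply: contrapT => nt; apply: nW; split => // /(sub _ _ t0t).
  by move=> t0w; apply: nW; split=> // _; exact: (sub _ _ t0t).
Qed.

End cofinal_measure.

(** * Labellings *)

Definition least (Q : nat -> Prop) : nat :=
  xget 0%N [set n | Q n /\ forall m, (m < n)%N -> ~ Q m].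

Lemma leastP (Q : nat -> Prop) : (exists n, Q n) ->
  Q (least Q) /\ forall m, (m < least Q)%N -> ~ Q m.
Proof.
move=> exQ; have exQb : exists n, `[< Q n >].
  by have [n Qn] := exQ; exists n; exact/asboolP.
rewrite /least; case: xgetP => [n _ //|].
case: (ex_minnP exQb) => n /asboolP Qn minn /(_ n) [].
split => // m mn /asboolP /minn.
by rewrite leqNgt mn.
Qed.

Lemma least_eq (Q : nat -> Prop) n : (exists n, Q n) ->
  least Q = n <-> Q n /\ forall m, (m < n)%N -> ~ Q m.
Proof.
move=> /leastP[Ql minl]; split => [<- //|[Qn minn]].
by case: (ltngtP (least Q) n) => // [/minn|/minl].
Qed.

Section measurable_labels.
Context {d : measure_display} {T : measurableType d}.

Lemma measurable_least (Q : T -> nat -> Prop) (n : nat) :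
  (forall w, exists n, Q w n) -> (forall n, measurable [set w | Q w n]) ->
  measurable [set w | least (Q w) = n].
Proof.
move=> exQ mQ.
rewrite (_ : [set _ | _] =
    [set w | Q w n] `&` ~` \bigcup_(m in `I_n) [set w | Q w m]).
  apply: measurableI => //; apply: measurableC.
  by apply: bigcup_measurable.
apply/seteqP; split => w.
  move=> /(least_eq _ (exQ w))[Qn minn]; split => // -[m /= mn].
  exact: minn.
move=> [Qn nQ]; apply/(least_eq _ (exQ w)); split => // m mn Qm.
by apply: nQ; exists m.
Qed.

(** The hypothesis is on joint events because, in a refinement, the value of the first label decides
    which labelling supplies the second. *)
Lemma measurable_pickle (f g : T -> nat) (m : nat) :
  (forall i j, measurable [set w | f w = i /\ g w = j]) ->
  measurable [set w | pickle (f w, g w) = m].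
Proof.
move=> mfg.
rewrite (_ : [set _ | _] = \bigcup_i \bigcup_j
    if pickle (i, j) == m then [set w | f w = i /\ g w = j] else set0).
  apply: bigcup_measurable => i _; apply: bigcup_measurable => j _.
  by case: ifP.
apply/seteqP; split => w.
  by move=> fgm; exists (f w) => //; exists (g w) => //; rewrite ifT//; exact/eqP.
by move=> [i _ [j _]]; case: ifPn => // /eqP <- [fi gj]; rewrite /= fi gj.
Qed.

End measurable_labels.

(** Bundled, so that a probability space can be chosen for each index of a family. *)
Record probspace (R : realType) := Probspace {
  ps_disp : measure_display;
  ps_space : measurableType ps_disp;
  ps_prob : probability ps_space R }.

Section labellings.
Context {R : realType} {M : metricType R}.
Implicit Types (C S : set M) (G : nat -> set (set M)) (r : R).

Lemma open_lt_mdist (z : M) r : open [set y | (r < mdist z y)%R].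
Proof.
rewrite openE => y /= ry; apply/nbhs_ballP.
exists (mdist z y - r)%R => /=; first by rewrite subr_gt0.
move=> y'; rewrite ballEmdist /=; have := metric_triangle z y' y.
by rewrite (metric_sym y' y); lra.
Qed.

Lemma open_gt_mdist (z : M) r : open [set y | (mdist z y < r)%R].
Proof.
rewrite openE => y /= yr; apply/nbhs_ballP.
exists (r - mdist z y)%R => /=; first by rewrite subr_gt0.
by move=> y'; rewrite ballEmdist /=; have := metric_triangle z y y'; lra.
Qed.

Lemma closed_ge_mdist (z : M) r : closed [set y | (r <= mdist z y)%R].
Proof.
rewrite (_ : [set _ | _] = ~` [set y | (mdist z y < r)%R]).
  exact/open_closedC/open_gt_mdist.
by apply/seteqP; split => y /=; rewrite leNgt => /negP.
Qed.

Lemma closed_le_mdist (z : M) r : closed [set y | (mdist z y <= r)%R].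
Proof.
rewrite (_ : [set _ | _] = ~` [set y | (r < mdist z y)%R]).
  exact/open_closedC/open_lt_mdist.
by apply/seteqP; split => y /=; rewrite leNgt => /negP.
Qed.

Lemma closed_subspaceI C F : closed F -> closed (C `&` F : set (subspace C)).
Proof.
by move=> cF; apply/closed_subspaceP; exists F => //; rewrite setIAC setIid setIC.
Qed.

(** The condition [G] on a fiber may depend on its label, so that a label can carry the center of a
    ball around the fiber. [tau] is a rate per unit distance, that is, sigma divided by the
    scale. *)
Definition labelling C (tau : R) G : Prop :=
  exists (X : probspace R) (k : ps_space X -> M -> nat),
  [/\ forall x i, C x -> measurable [set w | k w x = i],
      forall w x, C x -> G (k w x) [set y | C y /\ k w y = k w x] &
      forall x y, C x -> C y ->
        ps_prob X [set w | k w x <> k w y] <= (tau * mdist x y)%:E].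

Definition in_balls (zeta : nat -> M) r : nat -> set (set M) :=
  fun i S => S `<=` mcball (zeta i) r%:E.

Lemma labellingW C tau G G' : (forall i S, G i S -> G' i S) ->
  labelling C tau G -> labelling C tau G'.
Proof.
move=> GG' [X [k [mk Gk sk]]]; exists X, k; split => // w x Cx.
exact/GG'/Gk.
Qed.

Section random_partition_labels.
Context {d : measure_display} {T : measurableType d} (P : probability T R)
  (C : set M) (Gamma : nat -> T -> set M).
Hypothesis RP : random_partition C Gamma.

Lemma cluster_cover w x : C x -> exists i, Gamma i w x.
Proof.
have [cover _ _] := RP.2 w; rewrite -cover => -[_ [[i _ <-] _] Gx].
by exists i.
Qed.

Lemma cluster_subset i w : Gamma i w `<=` C.
Proof.
have [cover _ _] := RP.2 w; rewrite -cover => x Gx; exists (Gamma i w) => //.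
by split; [exists i|move=> /= G0; rewrite G0 in Gx].
Qed.

Lemma cluster_eq i j w x : Gamma i w x -> Gamma j w x -> Gamma i w = Gamma j w.
Proof.
have [_ tI _] := RP.2 w => Gi Gj; apply: tI; last by exists x.
  by split; [exists i|move=> /= G0; rewrite G0 in Gi].
by split; [exists j|move=> /= G0; rewrite G0 in Gj].
Qed.

(** Several indices may name the same cluster; the least one is the same for all of its points. *)
Definition index_label w x : nat := least (fun i => Gamma i w x).

Lemma index_labelP w x : C x -> Gamma (index_label w x) w x.
Proof. by move=> /(cluster_cover w) /leastP[]. Qed.

Lemma index_label_eq w x y : C x -> C y ->
  index_label w y = index_label w x <-> Gamma (index_label w x) w y.
Proof.
move=> Cx Cy; split => [<-|Gy]; first exact: index_labelP.
congr least; apply/funext => j; apply/propext; split => Gj.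
  by rewrite (cluster_eq Gj Gy); exact: index_labelP.
by rewrite (cluster_eq Gj (index_labelP w Cx)).
Qed.

Lemma cluster_ofE w x i : Gamma i w x -> cluster_of Gamma w x = Gamma i w.
Proof.
move=> Gx; rewrite /cluster_of /pblock /pblock_index.
case: xgetP => [S _ [[j _ <-] Sx]|/(_ (Gamma i w))[]].
  exact: cluster_eq Sx Gx.
by split => //; exists i.
Qed.

Lemma cluster_of_label w x : C x ->
  cluster_of Gamma w x = [set y | C y /\ index_label w y = index_label w x].
Proof.
move=> Cx; rewrite (cluster_ofE (index_labelP w Cx)).
apply/seteqP; split => y.
  by move=> Gy; have Cy := cluster_subset Gy; split => //; apply/index_label_eq.
by move=> [Cy /index_label_eq]; exact.
Qed.

Lemma cluster_of_neq x y : C x -> C y ->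
  [set w | cluster_of Gamma w x <> cluster_of Gamma w y] =
  [set w | index_label w x <> index_label w y].
Proof.
move=> Cx Cy; apply/seteqP; split => w /= ne e; apply: ne.
  by rewrite !cluster_of_label// e.
have : cluster_of Gamma w x x by rewrite cluster_of_label.
by rewrite e cluster_of_label// => -[].
Qed.

End random_partition_labels.
End labellings.

Section labelling_constructions.
Context {R : realType} {M : metricType R}.
Implicit Types (C S : set M) (G : nat -> set (set M)) (r e tau : R).

Definition dense_sequence (z : nat -> M) : Prop :=
  forall x e, (0 < e)%R -> exists n, (mdist (z n) x < e)%R.

Lemma separable_dense_sequence : separable M -> [set: M] !=set0 ->
  exists z, dense_sequence z.
Proof.
move=> [D /countable_injP[f fi] dD] [x0 _].
pose z n := xget x0 [set x | D x /\ f x = n].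
exists z => x e e0.
have [|y [/= xy Dy]] := dD _ _ (open_gt_mdist x e).
  by exists x; rewrite /= mdistxx.
exists (f y); rewrite /z; case: xgetP => [y' _ [Dy' /fi]|/(_ y)[]//].
by rewrite !inE => /(_ Dy' Dy) ->; rewrite metric_sym.
Qed.

Lemma rad_le_mcball S (x : M) r : (0 <= r)%R -> S `<=` mcball x r%:E ->
  Defs.rad S <= r%:E.
Proof.
by move=> r0 Sx; apply: ereal_inf_lbound; split; [rewrite lee_fin|exists x].
Qed.

(** The infimum in [rad] need not be attained, whence the slack [e]; the [eps] in the final bound
    makes room for it. *)
Lemma rad_mcball S r e : (0 < e)%R -> Defs.rad S <= r%:E ->
  exists x, S `<=` mcball x (r + e)%:E.
Proof.
move=> e0 radS; have : Defs.rad S < (r + e)%:E.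
  by apply: le_lt_trans radS _; rewrite lte_fin ltrDl.
move=> /ereal_inf_lt[r' [_ [x Sx]] r're]; exists x => y /Sx /= /le_trans; apply.
exact: ltW.
Qed.

Lemma rad_subset S S' : S `<=` S' -> Defs.rad S <= Defs.rad S'.
Proof.
move=> SS'; apply: ereal_inf_le_tmp => r [r0 [x S'x]]; split => //.
by exists x; exact: subset_trans S'x.
Qed.

Section random_partition_labellings.
Context {d : measure_display} {T : measurableType d} (P : probability T R)
  (C : set M) (Gamma : nat -> T -> set M) (Delta sigma r : R).
Hypotheses (RP : random_partition C Gamma)
  (radG : radially_bounded_partition C Gamma r)
  (sepG : separating P C Gamma Delta sigma).

Lemma measurable_index_label x i : C x ->
  measurable [set w | index_label Gamma w x = i].
Proof.
move=> Cx; apply: (measurable_least (Q := fun w i => Gamma i w x)).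
  by move=> w; exact: (cluster_cover RP).
(* The singleton of [x], written as a closed ball of radius 0, turns membership of [x] in a cluster
   into the hitting event of a closed set. *)
move=> j; rewrite (_ : [set _ | _] =
    [set w | (C `&` [set y | (mdist x y <= 0)%R]) `&` Gamma j w !=set0]).
  apply: RP.1; first exact: subIsetl.
  by apply: closed_subspaceI; exact: closed_le_mdist.
apply/seteqP; split => w /=.
  by move=> Gx; exists x; split => //; split => //=; rewrite mdistxx.
move=> [y [[_ /= xy] Gy]]; rewrite (_ : x = y)//.
by apply: mdist_positivity; apply/eqP; rewrite eq_le xy mdist_ge0.
Qed.

Lemma separating_index_label x y : C x -> C y ->
  P [set w | index_label Gamma w x <> index_label Gamma w y] <=
    (sigma / Delta * mdist x y)%:E.
Proof. by move=> Cx Cy; rewrite -(cluster_of_neq RP Cx Cy); exact: sepG. Qed.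

Lemma random_partition_labelling :
  labelling C (sigma / Delta) (fun _ S => Defs.rad S <= r%:E).
Proof.
exists (Probspace P), (index_label Gamma); split.
- by move=> x i; exact: measurable_index_label.
- by move=> w x Cx; rewrite -(cluster_of_label RP)//; exact: radG.
- exact: separating_index_label.
Qed.

(** The center is the first [z n] with no point of the cluster at distance [r + e] or more. This
    means missing a closed set, an event by strong measurability, so the choice is measurable; its
    index is packed into the label. *)
Lemma random_partition_centered (z : nat -> M) e : dense_sequence z ->
  (0 < e)%R ->
  exists zeta, labelling C (sigma / Delta) (in_balls zeta (r + e)).
Proof.
move=> dz e0.
pose far n := C `&` [set y | (r + e <= mdist (z n) y)%R].
pose near_center i w n := ~ (far n `&` Gamma i w !=set0).
have ex_center i w : exists n, near_center i w n.
  have [[x Gx]|G0] := pselect (Gamma i w !=set0); last first.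
    by exists 0%N => -[y [_ Gy]]; apply: G0; exists y.
  have Cx := cluster_subset RP Gx.
  (* Half of [e] pays for the infimum in [rad], half for replacing the center by a term of [z]. *)
  have e20 : (0 < e / 2)%R by rewrite divr_gt0.
  have := radG w Cx; rewrite (cluster_ofE RP Gx) => /(rad_mcball e20)[c Gc].
  have [n zn] := dz c _ e20; exists n => -[y [[_ /= far_y] Gy]].
  have := Gc _ Gy; rewrite /mcball /= lee_fin => cy.
  have := metric_triangle (z n) c y; lra.
pose center w i := least (near_center i w).
pose k w x := pickle (index_label Gamma w x, center w (index_label Gamma w x)).
(* The center is decoded from the label; numbers that are not codes get the dummy index 0. *)
exists (fun m =>
  z (if (unpickle m : option (nat * nat)) is Some (_, n) then n else 0%N)).
exists (Probspace P), k; split => /=.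
- move=> x m Cx; apply: measurable_pickle => i j.
  rewrite (_ : [set _ | _] =
      [set w | index_label Gamma w x = i] `&` [set w | center w i = j]);
    last first.
    by apply/seteqP; split => w /= [<- ?].
  apply: measurableI; first exact: measurable_index_label.
  apply: measurable_least; first by move=> w; exact: ex_center.
  move=> n; apply: measurableC; apply: RP.1; first exact: subIsetl.
  by apply: closed_subspaceI; exact: closed_ge_mdist.
- move=> w x Cx y [Cy /(pcan_inj pickleK)[ixy _]].
  rewrite /k pickleK /mcball /= lee_fin leNgt; apply/negP => far_y.
  have [near_w _] := leastP (ex_center (index_label Gamma w x) w).
  apply: near_w; exists y; split; first by split => //; exact: ltW.
  by rewrite -ixy; exact: (index_labelP RP).
- move=> x y Cx Cy; apply: le_trans (separating_index_label Cx Cy).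
  rewrite (_ : [set _ | _] =
    [set w | index_label Gamma w x <> index_label Gamma w y])//.
  apply/seteqP; split => w ne e'; apply: ne; first by rewrite /k e'.
  by have [] := pcan_inj pickleK e'.
Qed.

End random_partition_labellings.
End labelling_constructions.

(** * Refinement and strong measurability *)

Lemma measurable_label_neq {d : measure_display} {T : measurableType d}
    (f g : T -> nat) :
  (forall i, measurable [set w | f w = i]) ->
  (forall i, measurable [set w | g w = i]) ->
  measurable [set w | f w <> g w].
Proof.
move=> mf mg; rewrite (_ : [set _ | _] =
    ~` \bigcup_i ([set w | f w = i] `&` [set w | g w = i])).
  by apply/measurableC/bigcup_measurable => i _; exact: measurableI.
apply/seteqP; split => w /= fg.
  by move=> [i _ [fi gi]]; apply: fg; rewrite fi gi.
by move=> e; apply: fg; exists (f w).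
Qed.

(** * Refining a labelling by independent labellings of balls *)

Section refinement.
Context {R : realType} {M : metricType R}.
Variables (C : set M) (tau tau' r : R) (zeta : nat -> M)
  (G : nat -> nat -> set (set M)).
Hypotheses (tau'0 : (0 <= tau')%R)
  (G_hereditary : forall i j S S', S `<=` S' -> G i j S' -> G i j S).

(** The fine label of a point uses the sample attached to its coarse label, so points with a common
    coarse label use the same sample. For fixed coarse labels the separation probability is at most
    the indicator of coarse separation plus [tau'] times the distance; this is then integrated. *)
Lemma labelling_refine :
  labelling C tau (in_balls zeta r) ->
  (forall i, labelling (C `&` mcball (zeta i) r%:E) tau' (G i)) ->
  labelling C (tau + tau')
    (fun m S => exists i j, m = pickle (i, j) /\ G i j S).
Proof.
move=> [X [k [mk near_k sk]]] /choice[Y YP].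
pose l i := sval (cid (YP i)).
have lP i : [/\ _, _ & _] := svalP (cid (YP i)).
pose Q := product_measure (fun i => ps_prob (Y i)).
pose Omega : measurableType _ :=
  (ps_space X * product_space (fun i => ps_space (Y i)))%type.
pose PQ : probability Omega R := (ps_prob X \x Q)%E.
pose kl (z : Omega) x := pickle (k z.1 x, l (k z.1 x) (z.2 (k z.1 x)) x).
have in_ball w x : C x -> (C `&` mcball (zeta (k w x)) r%:E) x.
  by move=> Cx; split => //; apply: near_k.
have mkl x m : C x -> measurable [set z | kl z x = m].
  move=> Cx; apply: measurable_pickle => i j.
  (* Outside the ball of index [i] nothing is known about [l i] at [x], but there the coarse label
     [i] cannot occur. *)
  have [Bx|nBx] := pselect ((C `&` mcball (zeta i) r%:E) x); last first.
    rewrite (_ : [set _ | _] = set0)//; apply/seteqP; split => // z /= [ki _].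
    by apply: nBx; rewrite -ki; exact: in_ball.
  rewrite (_ : [set _ | _] = [set w | k w x = i] `*`
      [set v : product_space (fun i => ps_space (Y i)) | l i (v i) x = j]).
    apply: measurableX; first exact: mk.
    have [ml _ _] := lP i.
    exact: (measurable_product_coordinate (B := [set u | l i u x = j])
      (ml x j Bx)).
  by apply/seteqP; split => -[w v] /= [<- <-].
exists (Probspace PQ), kl; split => //=.
- move=> [w v] x Cx; exists (k w x), (l (k w x) (v (k w x)) x); split => //.
  have [_ Gl _] := lP (k w x).
  apply: G_hereditary (Gl (v (k w x)) x (in_ball w x Cx)) => y /=.
  move=> [Cy /(pcan_inj pickleK)[kxy lxy]].
  by split; [rewrite -kxy; exact: in_ball|move: lxy; rewrite kxy].
- move=> x y Cx Cy.
  pose B := [set w | k w x <> k w y].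
  have mB : measurable B by apply: measurable_label_neq => i; exact: mk.
  pose c := (tau' * mdist x y)%R.
  have c0 : (0 <= c)%R by rewrite mulr_ge0// mdist_ge0.
  have mS : measurable [set z | kl z x <> kl z y].
    by apply: measurable_label_neq => i; exact: mkl.
  have Sw w : Q (xsection [set z | kl z x <> kl z y] w) <= (\1_B w)%:E + c%:E.
    have [Bw|/contrapT kxy] := pselect (B w).
      rewrite indicE mem_set//; apply: (@le_trans _ _ 1); last by rewrite leeDl.
      by apply: probability_le1; exact: measurable_xsection.
    rewrite indicE memNset; last by move=> /(_ kxy).
    rewrite add0e; have [ml _ sl] := lP (k w x).
    have Bx := in_ball w x Cx; have By := in_ball w y Cy; rewrite -kxy in By.
    apply: le_trans (sl x y Bx By).
    rewrite -(product_measure_coordinate (fun i => ps_prob (Y i))); last first.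
      by apply: measurable_label_neq => i; exact: ml.
    rewrite /Q le_eqVlt; apply/orP; left; apply/eqP; congr product_measure.
    apply/seteqP; split => v; rewrite /xsection/= inE /kl/= -kxy.
      by move=> ne e; apply: ne; congr (pickle (_, _)).
    by move=> ne /(pcan_inj pickleK)[]; exact: ne.
  rewrite mulrDl EFinD; apply: le_trans (leeD2r _ (sk x y Cx Cy)).
  rewrite -[X in _ <= X + _]/(ps_prob X B).
  have -> : ps_prob X B + c%:E = \int[ps_prob X]_w ((\1_B w)%:E + c%:E).
    rewrite ge0_integralD//.
    + by rewrite integral_indic// setIT integral_cst//= probability_setT mule1.
    + exact/measurable_EFinP/measurable_indic.
  apply: ge0_le_integral => //.
  + exact: measurable_fun_xsection.
  + by apply: emeasurable_funD => //; exact/measurable_EFinP/measurable_indic.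
  + by move=> w _; exact: Sw.
Qed.

End refinement.

Section fibers.
Context {R : realType} {M : metricType R} {d : measure_display}
  {T : measurableType d}.
Variables (C : set M) (k : T -> M -> nat).

Definition fibers (m : nat) (w : T) : set M := [set y | C y /\ k w y = m].

Lemma fibers_partition w : partition (clusters fibers w `\ set0) id C.
Proof.
split.
- apply/seteqP; split => [y [_ [[m _ <-] _] []//]|y Cy].
  exists (fibers (k w y) w); last by [].
  by split; [exists (k w y)|apply/eqP/set0P; exists y].
- by move=> _ _ [[m _ <-] _] [[n _ <-] _] [y [[_ <-] [_ <-]]].
- by move=> S [_ S0]; apply/set0P/eqP.
Qed.

Lemma cluster_of_fibers w x : C x ->
  cluster_of fibers w x = [set y | C y /\ k w y = k w x].
Proof.
move=> Cx; rewrite /cluster_of /pblock /pblock_index.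
case: xgetP => [S _ [[j _ <-] [_ kx]]|/(_ (fibers (k w x) w))[]].
  by rewrite kx.
by split => //; exists (k w x).
Qed.

End fibers.

(** * From labellings back to random partitions *)

Section strongly_measurable_upgrade.
Context {R : realType} {M : metricType R}.

(* Only a countable subset t of C keeps its labels; every point lies in t almost
   surely, and the remaining points are grouped into fixed small cells. *)
Lemma labelling_SEPhat (C : set M) (z : nat -> M) (tau Delta : R) :
  dense_sequence z -> (0 < Delta)%R -> (0 <= tau)%R ->
  labelling C tau (fun _ S => Defs.rad S <= Delta%:E) ->
  SEPhat Delta C <= (Delta * tau)%:E.
Proof.
move=> dz Delta0 tau0 [X [k [mk radk sk]]].
(* Points with the same first index [n] form a cell, which lies in the ball of radius [Delta] around
   [z n]. *)
pose near y n := (mdist (z n) y < Delta)%R.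
have ex_near y : exists n, near y n by exact: dz.
pose cell y := least (near y).
pose Omega := cofinal_space (ps_prob X) M.
(* The Boolean keeps labels and cell numbers apart, so that no cluster mixes listed and unlisted
   points. *)
pose kappa (w : Omega) y : nat :=
  if `[< listed w.2 y >] then pickle (true, k w.1 y) else pickle (false, cell y).
apply: ereal_inf_lbound; exists (Delta * tau)%R => //.
split; first by rewrite mulr_ge0// ltW.
exists _, Omega, (@cofinal_measure _ _ _ (ps_prob X) M), (fibers C kappa); split.
- split; last by move=> w; exact: fibers_partition.
  move=> m E EC _.
  have hitE : [set w | E `&` fibers C kappa m w !=set0] =
      [set w | exists2 y, E y & kappa w y = m].
    apply/seteqP; split => w; first by move=> [y [Ey [_ km]]]; exists y.
    by move=> [y Ey km]; exists y; split => //; split => //; exact: EC.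
  rewrite hitE.
  have [[[b i] mE]|nm] := pselect (exists bi : bool * nat, m = pickle bi);
    last first.
    rewrite (_ : [set _ | _] = set0)//; apply/seteqP; split => // w [y _ km].
    apply: nm; move: km; rewrite /kappa; case: asboolP => _ <-.
      by exists (true, k w.1 y).
    by exists (false, cell y).
  case: b mE => ->.
    rewrite (_ : [set _ | _] =
        [set w | exists y, [/\ E y, listed w.2 y & k w.1 y = i]]).
      apply: (@measurable_cofinal_bigcup _ _ _ (ps_prob X) M E
        (fun y => [set w | k w y = i])) => y Ey.
      by apply: mk; exact: EC.
    apply/seteqP; split => w.
      move=> [y Ey]; rewrite /kappa.
      case: asboolP => ty /(pcan_inj pickleK)// [ki].
      by exists y.
    by move=> [y [Ey ty ki]]; exists y => //; rewrite /kappa asboolT// ki.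
  rewrite (_ : [set _ | _] =
      [set w | exists y, [/\ E y, ~ listed w.2 y & cell y = i]]); last first.
    apply/seteqP; split => w.
      move=> [y Ey]; rewrite /kappa.
      case: asboolP => ty /(pcan_inj pickleK)// [ki].
      by exists y.
    by move=> [y [Ey ty ki]]; exists y => //; rewrite /kappa asboolF// ki.
  (* Countably many points are all listed by some [t0], so the event is empty above [t0];
     uncountably many are never exhausted, so it is the whole space for every [t]. *)
  have [cA|ncA] := pselect (countable (E `&` [set y | cell y = i])).
    have [t0 At0] := listed_countable cA.
    apply: (cofinal_measure_const (t0 := t0) (B := set0) _ _).1 => // t t0t.
    apply/seteqP; split => // w [y [Ey nty cy]]; apply: nty; apply: t0t.
    exact: At0.
  apply: (cofinal_measure_const (t0 := point) (B := setT) _ _).1 => // t _.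
  apply/seteqP; split => // w _; apply: contrapT => noy; apply: ncA.
  apply: sub_countable (countable_listed t); apply: subset_card_le => y [Ey cy].
  by apply: contrapT => nty; apply: noy; exists y.
- move=> w x Cx; rewrite cluster_of_fibers//.
  have [tx|ntx] := pselect (listed w.2 x).
    apply: le_trans (radk w.1 x Cx); apply: rad_subset => y [Cy].
    rewrite {2}/kappa (asboolT tx) /kappa.
    by case: asboolP => _ /(pcan_inj pickleK)// [].
  apply: (@rad_le_mcball _ _ _ (z (cell x))); first exact: ltW.
  move=> y [Cy]; rewrite {2}/kappa (asboolF ntx) /kappa.
  case: asboolP => _ /(pcan_inj pickleK)// [<-]; rewrite /mcball/= lee_fin ltW//.
  by have [] := leastP (ex_near y).
- move=> x y Cx Cy.
  (* Above [t0] both points keep their labels, so the separation event has the section given by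
     [k]. *)
  have [t0 t0xy] : exists t0, [set x; y] `<=` listed t0.
    by apply: listed_countable; exact: finite_set_countable.
  have mB : measurable [set w | k w x <> k w y].
    by apply: measurable_label_neq => i; exact: mk.
  rewrite (_ : [set w | _ <> _] = [set w | kappa w x <> kappa w y]); last first.
    apply/seteqP; split => w ne e; apply: ne.
      by rewrite !cluster_of_fibers// e.
    have : cluster_of (fibers C kappa) w x x by rewrite cluster_of_fibers.
    by rewrite e cluster_of_fibers// => -[].
  have [|_ PS] := @cofinal_measure_const _ _ _ (ps_prob X) M
      [set w | kappa w x <> kappa w y] t0 _ mB.
    move=> t t0t; rewrite /section_at /kappa/=.
    rewrite !asboolT; last 2 first.
    - by apply: t0t; apply: t0xy; right.
    - by apply: t0t; apply: t0xy; left.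
    apply/seteqP; split => w /= ne e; apply: ne; first by rewrite e.
    by have [] := pcan_inj pickleK e.
  rewrite -[X in X <= _]/(@cofinal_measure _ _ _ (ps_prob X) M
    [set w | kappa w x <> kappa w y]) PS.
  by rewrite [(Delta * tau)%R]mulrC mulfK ?gt_eqF//; exact: sk.
Qed.

End strongly_measurable_upgrade.

(** * Moduli and the multiscale bound *)

Section moduli_labellings.
Context {R : realType} {M : metricType R}.
Implicit Types (C : set M) (r s tau : R).

Lemma labelling_le C tau tau' G : (tau <= tau')%R ->
  labelling C tau G -> labelling C tau' G.
Proof.
move=> tt' [X [k [mk Gk sk]]]; exists X, k; split => // x y Cx Cy.
by apply: le_trans (sk x y Cx Cy) _; rewrite lee_fin ler_wpM2r// mdist_ge0.
Qed.

Lemma labelling_rad_subset C C' tau r : C' `<=` C ->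
  labelling C tau (fun _ S => Defs.rad S <= r%:E) ->
  labelling C' tau (fun _ S => Defs.rad S <= r%:E).
Proof.
move=> C'C [X [k [mk radk sk]]]; exists X, k; split.
- by move=> x i /C'C; exact: mk.
- move=> w x /C'C Cx; apply: le_trans (radk w x Cx); apply: rad_subset => y [? ?].
  by split => //; exact: C'C.
- by move=> x y /C'C Cx /C'C Cy; exact: sk.
Qed.

Lemma SEPhat_ge0 r C : 0 <= SEPhat r C.
Proof. by apply: le_ereal_inf_tmp => _ [s [s0 _] <-]; rewrite lee_fin. Qed.

Lemma SEPhat_lt_labelling r C s : (0 < r)%R -> SEPhat r C < s%:E ->
  labelling C (s / r) (fun _ S => Defs.rad S <= r%:E).
Proof.
move=> r0 /ereal_inf_lt[_ [sg [sg0 [d [T [P [Gamma [RP rb sp]]]]]] <-]].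
rewrite lte_fin => /ltW sgs.
apply: (@labelling_le _ (sg / r)); first by rewrite ler_pM2r// invr_gt0.
exact: random_partition_labelling RP rb sp.
Qed.

Section dense.
Variables (z : nat -> M) (dense_z : dense_sequence z).

Lemma SEPhat_lt_centered r C s e : (0 < r)%R -> (0 < e)%R -> SEPhat r C < s%:E ->
  exists zeta, labelling C (s / r) (in_balls zeta (r + e)).
Proof.
move=> r0 e0 /ereal_inf_lt[_ [sg [sg0 [d [T [P [Gamma [RP rb sp]]]]]] <-]].
rewrite lte_fin => /ltW sgs.
have [zeta lz] := random_partition_centered RP rb sp dense_z e0.
by exists zeta; apply: labelling_le lz; rewrite ler_pM2r// invr_gt0.
Qed.

Lemma SEP_lt_centered r C s e : (0 < r)%R -> (0 < e)%R -> SEP r C < s%:E ->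
  exists zeta, labelling C (s / r) (in_balls zeta (r + e)).
Proof.
move=> r0 e0 /ereal_inf_lt[_ [sg [sg0 [d [T [P [Gamma [RP db sp]]]]]] <-]].
rewrite lte_fin => /ltW sgs.
have rb : radially_bounded_partition C Gamma r.
  move=> w x Cx; apply: (@rad_le_mcball _ _ _ x); first exact: ltW.
  move=> y xy; rewrite /mcball /=; apply: le_trans (db w x Cx).
  apply: ereal_sup_ubound; exists x; last by exists y.
  by rewrite (cluster_of_label RP).
have [zeta lz] := random_partition_centered RP rb sp dense_z e0.
by exists zeta; apply: labelling_le lz; rewrite ler_pM2r// invr_gt0.
Qed.

(** A set closed in [C'] need not be closed in [C], so intersecting clusters with [C'] may lose
    strong measurability. Labellings do restrict, and [labelling_SEPhat] returns from them. *)
Lemma le_SEPhat r C C' : (0 < r)%R -> C' `<=` C -> SEPhat r C' <= SEPhat r C.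
Proof.
move=> r0 C'C; have := SEPhat_ge0 r C.
case E : (SEPhat r C) => [v| |] // v0; last by rewrite leey.
apply/lee_addgt0Pr => e e0.
have lt : SEPhat r C < (v + e)%:E by rewrite E lte_fin ltrDl.
have ve0 : (0 <= v + e)%R by rewrite addr_ge0// ltW.
have := labelling_rad_subset C'C (SEPhat_lt_labelling r0 lt).
move=> /(labelling_SEPhat dense_z r0); rewrite divr_ge0// => [/(_ isT)|];
  last exact: ltW.
by rewrite mulrC divfK// gt_eqF.
Qed.

Lemma labelling_refine_centered C tau tau' r r' (zeta : nat -> M) :
  (0 <= tau')%R -> labelling C tau (in_balls zeta r) ->
  (forall x, exists zeta', labelling (C `&` mcball x r%:E) tau' (in_balls zeta' r')) ->
  exists zeta', labelling C (tau + tau') (in_balls zeta' r').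
Proof.
move=> t0 lz lx; have /choice[zetas zl] := fun i => lx (zeta i).
have her i j S S' :
    S `<=` S' -> in_balls (zetas i) r' j S' -> in_balls (zetas i) r' j S.
  by move=> SS' S'z; exact: subset_trans S'z.
have lab := labelling_refine t0 her lz zl.
exists (fun m => if unpickle m is Some (i, j) then zetas i j else z 0).
apply: labellingW lab => m S [i [j [-> Sj]]].
by rewrite /in_balls pickleK.
Qed.

Lemma labelling_refine_rad C tau tau' r r' (zeta : nat -> M) :
  (0 <= tau')%R -> labelling C tau (in_balls zeta r) ->
  (forall x, labelling (C `&` mcball x r%:E) tau'
    (fun _ S => Defs.rad S <= r'%:E)) ->
  labelling C (tau + tau') (fun _ S => Defs.rad S <= r'%:E).
Proof.
move=> t0 lz lx.
have her (i j : nat) (S S' : set M) :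
    S `<=` S' -> Defs.rad S' <= r'%:E -> Defs.rad S <= r'%:E.
  by move=> SS'; apply: le_trans; exact: rad_subset.
have := labelling_refine t0 her lz (fun i => lx (zeta i)).
by apply: labellingW => m S [i [j []]].
Qed.

End dense.
End moduli_labellings.

(** * Descent through the scales *)

Section multiscale.
Context {R : realType} {M : metricType R}.
Variables (C : set M) (z : nat -> M) (Delta K : R).
Hypotheses (dense_z : dense_sequence z) (Delta_gt0 : (0 < Delta)%R) (K_gt1 : (1 < K)%R).

Let Ks_gt0 s : (0 < K ^+ s)%R.
Proof. by rewrite exprn_gt0// (lt_trans _ K_gt1). Qed.

Let KsD_gt0 s : (0 < K ^+ s * Delta)%R.
Proof. by rewrite mulr_gt0. Qed.

Definition local_SEPhat (s : nat) (eps : R) : \bar R :=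
  ereal_sup (range (fun x : M =>
    SEPhat (K ^+ s * Delta) (C `&` mcball x (K ^+ s.+1 * Delta + eps)%:E))).

Lemma local_SEPhat_ge0 s eps : 0 <= local_SEPhat s eps.
Proof.
apply: le_trans (SEPhat_ge0 (K ^+ s * Delta)
  (C `&` mcball (z 0) (K ^+ s.+1 * Delta + eps)%:E)) _.
by apply: ereal_sup_ubound; exists (z 0).
Qed.

(** Larger [eps] gives larger balls, so [le_SEPhat] makes the expression nondecreasing and its right
    limit at 0 an infimum. *)
Lemma local_SEPhat_cvg s :
  local_SEPhat s eps @[eps --> (0 : R)^'+] -->
  ereal_inf (local_SEPhat s @` [set` `]0, +oo[%R]).
Proof.
apply: nondecreasing_at_right_cvge => // e e' _ _ ee'.
apply: ge_ereal_sup => _ [x _ <-].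
apply: (@le_trans _ _ (SEPhat (K ^+ s * Delta)
    (C `&` mcball x (K ^+ s.+1 * Delta + e')%:E))).
  apply: (le_SEPhat dense_z) => //; apply: setIS => y; rewrite /mcball/= => /le_trans.
  by apply; rewrite lee_fin lerD2l.
by apply: ereal_sup_ubound; exists x.
Qed.

Definition limit_SEPhat (s : nat) : \bar R :=
  lim (local_SEPhat s eps @[eps --> (0 : R)^'+]).

Lemma limit_SEPhatE s :
  limit_SEPhat s = ereal_inf (local_SEPhat s @` [set` `]0, +oo[%R]).
Proof. by apply/cvg_lim => //; exact: local_SEPhat_cvg. Qed.

Lemma limit_SEPhat_ge0 s : 0 <= limit_SEPhat s.
Proof.
by rewrite limit_SEPhatE; apply: le_ereal_inf_tmp => _ [e _ <-]; exact: local_SEPhat_ge0.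
Qed.

Lemma limit_SEPhat_lt s v : limit_SEPhat s < v%:E ->
  exists2 e, (0 < e)%R & forall x,
    SEPhat (K ^+ s * Delta) (C `&` mcball x (K ^+ s.+1 * Delta + e)%:E) < v%:E.
Proof.
rewrite limit_SEPhatE => /ereal_inf_lt[_ [e /= + <-] lt].
rewrite in_itv/= andbT => e0; exists e => // x; apply: le_lt_trans lt.
by apply: ereal_sup_ubound; exists x.
Qed.

Lemma telescoped_bound (a : nat -> R) (n : nat) (eta : R) :
  (0 < n)%N -> (0 <= eta)%R ->
  (forall s, 0 <= a s)%R ->
  (forall s, limit_SEPhat s < (a s)%:E) ->
  SEP (K ^+ n * Delta) C < (eta * (K ^+ n * Delta))%:E ->
  SEPhat Delta C <= (Delta * eta + \sum_(0 <= s < n) a s / K ^+ s)%:E.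
Proof.
move=> n0 eta0 a0 La SEPn.
have /choice[e eP] : forall s, exists e, (0 < e)%R /\ forall x,
    SEPhat (K ^+ s * Delta) (C `&` mcball x (K ^+ s.+1 * Delta + e)%:E) < (a s)%:E.
  by move=> s; have [e e0 ex] := limit_SEPhat_lt (La s); exists e.
(* The separation rate at scale [m]: [eta] from the starting partition at scale [n], plus one term
   for each refinement down to [m]. *)
pose tau m := (eta + \sum_(m <= s < n) a s / (K ^+ s * Delta))%R.
have a_ge0 s : (0 <= a s / (K ^+ s * Delta))%R by rewrite divr_ge0// ltW.
have tauS m : (m < n)%N -> tau m = (tau m.+1 + a m / (K ^+ m * Delta))%R.
  by move=> mn; rewrite /tau big_ltn// -addrA [(_ + a m / _)%R]addrC.
(* The slack at scale [n - j] is the one allowed by the next refinement, to scale [n - j - 1],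
   whence the predecessor in the index of [e]. *)
have level j : (j < n)%N -> exists zeta,
    labelling C (tau (n - j)%N) (in_balls zeta (K ^+ (n - j) * Delta + e (n - j).-1%N)).
  elim: j => [_|j IH jn].
    rewrite subn0 /tau big_geq// addr0.
    have := SEP_lt_centered dense_z (KsD_gt0 n) (eP n.-1).1 SEPn.
    by rewrite mulfK// gt_eqF.
  have [zeta lz] := IH (ltnW jn).
  have mE : (n - j = (n - j.+1).+1)%N by rewrite subnSK// ltnW.
  have m0 : (0 < n - j.+1)%N by rewrite subn_gt0.
  move: lz; rewrite mE; move: (n - j.+1)%N m0 (leq_subr j n) mE => m m0 mn mE lz.
  rewrite tauS; last by rewrite -mE.
  apply: labelling_refine_centered lz _ => // x.
  exact: (SEPhat_lt_centered dense_z (KsD_gt0 m) (eP m.-1).1 ((eP m).2 x)).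
have [|zeta] := level n.-1; first by rewrite prednK.
rewrite (_ : n - n.-1 = 1)%N => [lz|]; last first.
  by case: n n0 {SEPn tauS level tau} => // n _; rewrite subSnn.
(* The last refinement must give radius [Delta] without slack, so it bounds [rad] directly and
   chooses no centers. *)
have l0 : labelling C (tau 0%N) (fun _ S => Defs.rad S <= Delta%:E).
  rewrite tauS//; apply: labelling_refine_rad lz _ => // x.
  have := SEPhat_lt_labelling (KsD_gt0 0) ((eP 0%N).2 x).
  by rewrite expr0 mul1r.
have tau_ge0 : (0 <= tau 0%N)%R by rewrite addr_ge0// sumr_ge0.
apply: le_trans (labelling_SEPhat dense_z Delta_gt0 tau_ge0 l0) _.
rewrite lee_fin /tau mulrDr lerD2l mulr_sumr ler_sum// => s _.
by rewrite invfM mulrCA [(Delta * (_ * _))%R]mulrCA divff ?mulr1// gt_eqF.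
Qed.

Lemma exists_scale_gt (A : R) : exists2 n, (0 < n)%N & (A < K ^+ n * Delta)%R.
Proof.
have K1 : (`|K^-1| < 1)%R.
  by rewrite ger0_norm ?invr_ge0 ?ltW ?(lt_trans _ K_gt1)// invf_lt1// (lt_trans _ K_gt1).
have A0 : (0 < `|A| + 1)%R by rewrite ltr_pwDr.
have e0 : (0 < Delta / (`|A| + 1))%R by rewrite divr_gt0.
have /cvgr0_norm_lt /(_ _ e0) [N _ NP] := cvg_expr K1.
have := NP N.+1 (leqnSn _).
rewrite /= exprVn ger0_norm ?invr_ge0 ?(ltW (Ks_gt0 _))// => lt.
move: lt; rewrite ltr_pdivlMr// mulrC ltr_pdivrMr// mulrC => lt.
exists N.+1 => //; apply: le_lt_trans (ler_norm A) _; apply: lt_trans lt.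
by rewrite ltrDl.
Qed.

End multiscale.

Theorem lemma1p16 (R : realType) (M : metricType R) (C : set M)
  (M_separable : separable M)
  (C_nonempty : C !=set0)
  (SEP_sublinear :
     (1 / Delta)%:E * SEP Delta C @[Delta --> +oo%R] --> (0 : \bar R))
  (Delta K : R) (Delta_gt0 : (0 < Delta)%R) (K_gt1 : (1 < K)%R) :
  SEPhat Delta C <=
    \sum_(0 <= s <oo)
      (1 / K ^+ s)%:E *
      lim ((ereal_sup (range (fun z : M =>
              SEPhat (K ^+ s * Delta)
                (C `&` mcball z (K ^+ s.+1 * Delta + eps)%:E))))
           @[eps --> (0 : R)^'+]).
Proof.
have [z dense_z] : exists z : nat -> M, dense_sequence z.
  by apply: separable_dense_sequence => //; have [x _] := C_nonempty; exists x.
have K_gt0 : (0 < K)%R by rewrite (lt_trans _ K_gt1).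
have Ks_gt0 s : (0 < K ^+ s)%R by rewrite exprn_gt0.
rewrite -[X in _ <= X]/(\sum_(0 <= s <oo) (1 / K ^+ s)%:E * limit_SEPhat C Delta K s).
set L := limit_SEPhat C Delta K.
have L_ge0 s : 0 <= L s by exact: (limit_SEPhat_ge0 C dense_z Delta_gt0 K_gt1).
have term_ge0 s : 0 <= (1 / K ^+ s)%:E * L s.
  by rewrite mule_ge0// lee_fin divr_ge0// ltW.
(* An infinite series leaves nothing to prove; for a finite one, nonnegative terms force every [L s]
   to be finite. *)
have [->|] := eqVneq (\sum_(0 <= s <oo) (1 / K ^+ s)%:E * L s) +oo; first by rewrite leey.
rewrite -ltey => sum_fin.
have L_fin s : L s \is a fin_num.
  rewrite ge0_fin_numE// ltey; apply/eqP => Loo; move: sum_fin; rewrite ltNge => /negP[].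
  apply: le_trans (nneseries_lim_ge s.+1 (fun i _ _ => term_ge0 i)).
  rewrite big_nat_recr//= Loo gt0_muley ?lte_fin ?divr_gt0// addey//.
  by rewrite gt_eqF// (lt_le_trans ltNy0)// sume_ge0.
apply/lee_addgt0Pr => e e0.
(* Chosen so that [Delta * eta + eta = e]: the first term pays for the starting partition, the
   second is split into [eta / n] for each of the [n] scales. *)
pose eta := (e / (Delta + 1))%R.
have D1 : (0 < Delta + 1)%R by rewrite addr_gt0.
have eta0 : (0 < eta)%R by rewrite divr_gt0.
have [A [_ SEP_small]] : nbhs +oo%R [set D | (1 / D)%:E * SEP D C < eta%:E].
  apply: (SEP_sublinear [set x | x < eta%:E]); apply: open_nbhs_nbhs; split.
    exact: open_ereal_lt_ereal.
  by rewrite /= lte_fin.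
have [n n0 An] := exists_scale_gt Delta_gt0 K_gt1 A.
have KnD : (0 < K ^+ n * Delta)%R by rewrite mulr_gt0.
have SEPn : SEP (K ^+ n * Delta) C < (eta * (K ^+ n * Delta))%:E.
  by have := SEP_small _ An; rewrite /= div1r lte_pdivrMl// muleC EFinM.
pose a s := (fine (L s) + eta / n%:R)%R.
have n_gt0 : (0 < n%:R :> R)%R by rewrite ltr0n.
have La s : L s < (a s)%:E.
  by rewrite -(fineK (L_fin s)) lte_fin ltrDl divr_gt0.
have a0 s : (0 <= a s)%R by rewrite addr_ge0 ?fine_ge0// divr_ge0// ltW.
apply: le_trans (telescoped_bound dense_z Delta_gt0 K_gt1 n0 (ltW eta0) a0 La SEPn) _.
apply: (@le_trans _ _ (\sum_(0 <= s < n) (1 / K ^+ s)%:E * L s + e%:E)); last first.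
  by rewrite leeD2r//; exact: nneseries_lim_ge.
rewrite (eq_bigr (fun s => (1 / K ^+ s * fine (L s))%:E)); last first.
  by move=> s _; rewrite [RHS]EFinM fineK.
rewrite sumEFin -EFinD lee_fin.
have -> : (e = Delta * eta + eta)%R.
  by rewrite -[X in (_ + X)%R]mul1r -mulrDl mulrC divfK// gt_eqF.
suff : (\sum_(0 <= s < n) a s / K ^+ s <=
    \sum_(0 <= s < n) 1 / K ^+ s * fine (L s) + eta)%R by lra.
have -> : eta = (\sum_(0 <= s < n) eta / n%:R)%R.
  by rewrite sumr_const_nat subn0 -[RHS]mulr_natr divfK// gt_eqF.
(* The share [eta / n] enters with weight [1 / K ^+ s], which is at most 1. *)
rewrite -big_split/= ler_sum// => s _.
rewrite mulrDl div1r [(_^-1 * _)%R]mulrC lerD2l ler_pdivrMr// ler_peMr//.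
  by rewrite divr_ge0// ltW.
by rewrite exprn_ege1// ltW.
Qed.
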